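(* For each integer $p\ge 3$ let $P^{(p)}$ be a regular $p$-gon (the closed polygonal curve) inscribed in the unit circle of the plane. Then $$\lim_{p\to\infty}\ \inf\{h(P^{(p)},E) : E \text{ is a polyellipse}\}=0.$$
   Context: $d$ denotes the Euclidean distance in the plane. Given finitely many not necessarily different points $F_1,\ldots,F_m$ ($m\ge 1$, $m$ arbitrary) in the plane and a real number $c$, the set $\{X\in\mathbb{R}^2 : \sum_{i=1}^m d(X,F_i)=c\}$ (assumed nonempty) is called a polyellipse with focuses $F_1,\ldots,F_m$. The Hausdorff distance of nonempty compact sets $K,L\subset\mathbb{R}^2$ is $h(K,L)=\max\{\max_{X\in K}\min_{Y\in L}d(X,Y),\ \max_{Y\in L}\min_{X\in K}d(X,Y)\}$. *)

(* Defs.v *)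
From mathcomp Require Import all_boot all_order all_algebra.
From mathcomp Require Import all_classical all_reals all_analysis.

Set Implicit Arguments.
Unset Strict Implicit.
Unset Printing Implicit Defensive.

Import Order.TTheory GRing.Theory Num.Theory.
Import numFieldNormedType.Exports.

Local Open Scope classical_set_scope.
Local Open Scope ring_scope.

(* The norm that the library puts on R * R is the sup norm, so the Euclidean
   distance is written out. *)
Definition dist2 (R : realType) (A B : R * R) : R :=
  Num.sqrt ((A.1 - B.1) ^+ 2 + (A.2 - B.2) ^+ 2).

(* Since 'I_m -> R * R need not be injective, focuses may be repeated. *)
Definition is_polyellipse (R : realType) (E : set (R * R)) : Prop :=
  exists (m : nat) (F : 'I_m -> R * R) (c : R),
    [/\ (0 < m)%N,
        E = [set X | \sum_(i < m) dist2 X (F i) = c]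
      & E !=set0].

(* Extended-real suprema and infima stand for the maxima and minima: they are
   attained, with finite values, when K and L are nonempty and compact, as
   polygons and polyellipses are. *)
Definition hausdorff_dist (R : realType) (K L : set (R * R)) : \bar R :=
  maxe
    (ereal_sup [set ereal_inf [set (dist2 X Y)%:E | Y in L] | X in K])
    (ereal_sup [set ereal_inf [set (dist2 X Y)%:E | X in K] | Y in L]).

Definition segment2 (R : realType) (A B : R * R) : set (R * R) :=
  [set (line_path A.1 B.1 t, line_path A.2 B.2 t) | t in `[0, 1]].

Definition gon_vertex (R : realType) (p : nat) (theta : R) (k : nat) : R * R :=
  let a := theta + 2 * pi * k%:R / p%:R in (cos a, sin a).

(* A regular p-gon inscribed in the unit circle is determined up to a rotation,
   here the angle theta of its first vertex. The edge k = p - 1 closes the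
   curve, because the vertices of index p and 0 coincide. *)
Definition is_regular_gon (R : realType) (p : nat) (P : set (R * R)) : Prop :=
  exists theta : R,
    P = [set X | exists2 k : nat, (k < p)%N &
          segment2 (gon_vertex p theta k) (gon_vertex p theta k.+1) X].

(* Main.v *)
(* The unit circle is itself a polyellipse, with the single focus (0, 0), so it
   suffices to bound its Hausdorff distance to the p-gon. Since cos and sin are
   1-Lipschitz, every point of the p-gon and every point of the circle lies
   within 4 pi / p of a vertex, and the vertices belong to both curves. *)
Require Import Defs.
From mathcomp Require Import all_boot all_order all_algebra.
From mathcomp Require Import all_classical all_reals all_analysis.
From mathcomp Require Import ring lra.

Set Implicit Arguments.
Unset Strict Implicit.
Unset Printing Implicit Defensive.

Import Order.TTheory GRing.Theory Num.Theory.
Import numFieldNormedType.Exports.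

Local Open Scope classical_set_scope.
Local Open Scope ring_scope.

Lemma lipschitz1_derive (R : realType) (f df : R -> R)
    (fdf : forall x : R, is_derive x 1 f (df x))
    (df1 : forall x : R, `|df x| <= 1) (a b : R) :
  `|f a - f b| <= `|a - b|.
Proof.
wlog ab : a b / a <= b.
  move=> H; have [/H//|/ltW/H] := leP a b.
  by rewrite distrC (distrC b).
have cf : {within `[a, b], continuous f}.
  apply: continuous_subspaceT => x.
  by apply/differentiable_continuous/derivable1_diffP; case: (fdf x).
have [c _ fE] := MVT_segment ab (fun x _ => fdf x) cf.
by rewrite distrC fE normrM (distrC a) ler_piMl.
Qed.

(** The square of the right-hand side exceeds the sum of squares by a nonnegative cross term. Later
    estimates are thus made coordinate by coordinate, at the cost of a factor 2. *)
Lemma dist2_le_norm (R : realType) (A B : R * R) :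
  dist2 A B <= `|A.1 - B.1| + `|A.2 - B.2|.
Proof.
rewrite /dist2 -[leRHS]ger0_norm ?addr_ge0// -sqrtr_sqr ler_wsqrtr//.
rewrite -(real_normK (num_real (A.1 - B.1))).
rewrite -(real_normK (num_real (A.2 - B.2))).
by rewrite sqrrD lerD2r lerDl mulrn_wge0// mulr_ge0.
Qed.

(** [gon_vertex p theta k] is convertible to a [circle_point], so the lemmas below apply to vertices
    directly. *)
Definition circle_point (R : realType) (a : R) : R * R := (cos a, sin a).

Lemma norm_circle_point1 (R : realType) (a b : R) :
  `|(circle_point a).1 - (circle_point b).1| <= `|a - b|.
Proof.
apply: (@lipschitz1_derive _ _ (fun x => - sin x)) => x.
by rewrite normrN ler_norml sin_geN1 sin_le1.
Qed.

Lemma norm_circle_point2 (R : realType) (a b : R) :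
  `|(circle_point a).2 - (circle_point b).2| <= `|a - b|.
Proof.
apply: (@lipschitz1_derive _ _ cos) => x.
by rewrite ler_norml cos_geN1 cos_le1.
Qed.

Lemma dist2_circle_point (R : realType) (a b : R) :
  dist2 (circle_point a) (circle_point b) <= `|a - b| *+ 2.
Proof.
apply: le_trans (dist2_le_norm _ _) _.
by rewrite mulr2n lerD ?norm_circle_point1 ?norm_circle_point2.
Qed.

Lemma dist2_segment_circle (R : realType) (a b : R) (X : R * R) :
  segment2 (circle_point a) (circle_point b) X ->
  dist2 X (circle_point a) <= `|a - b| *+ 2.
Proof.
move=> [t]; rewrite /= in_itv/= => /andP[t0 t1] <-.
have line_sub (u v : R) : `|u - v| <= `|a - b| ->
    `|line_path u v t - u| <= `|a - b|.
  (* Moving along the chord covers only a fraction [t <= 1] of each coordinate difference. *)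
  have -> : line_path u v t - u = t * (v - u) by rewrite /line_path; ring.
  by rewrite normrM ger0_norm// distrC; apply: le_trans; rewrite ler_piMl.
apply: le_trans (dist2_le_norm _ _) _.
rewrite mulr2n lerD ?line_sub//.
  exact: norm_circle_point1.
exact: norm_circle_point2.
Qed.

Lemma unit_circle_angle (R : realType) (x y : R) : x ^+ 2 + y ^+ 2 = 1 ->
  exists2 s : R, 0 <= s < 2 * pi & (x, y) = circle_point s.
Proof.
move=> xy1.
have pi0 := pi_gt0 R.
have yE : y ^+ 2 = 1 - x ^+ 2 by rewrite -xy1; ring.
have x1 : -1 <= x <= 1.
  rewrite -ler_norml -(@expr_le1 _ 2)// real_normK ?num_real//.
  by rewrite -xy1 lerDl sqr_ge0.
have acos0 := acos_ge0 x1; have acospi := acos_lepi x1.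
have sqrtE : Num.sqrt (1 - x ^+ 2) = `|y| by rewrite -yE sqrtr_sqr.
have [y0|y0] := leP 0 y.
  exists (acos x); first by rewrite acos0 /=; lra.
  by rewrite /circle_point acosK ?in_itv// sin_acos// sqrtE ger0_norm.
(* Since [y < 0] excludes [x = 1], the angle [2 * pi - acos x] stays strictly below [2 * pi]. *)
have acosx0 : 0 < acos x.
  rewrite acos_gt0//; case/andP: x1 => -> /= x1; rewrite lt_neqAle x1 andbT.
  apply/eqP => xE; move: yE; rewrite xE; nra.
exists (2 * pi - acos x); first by apply/andP; split; lra.
have -> : 2 * pi - acos x = - acos x + pi *+ 2 by rewrite -mulr_natl; ring.
rewrite /circle_point cosD2pi sinD2pi cosN sinN acosK ?in_itv//.
by rewrite sin_acos// sqrtE ltr0_norm// opprK.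
Qed.

Lemma circle_angle_from (R : realType) (theta : R) (Y : R * R) :
  Y.1 ^+ 2 + Y.2 ^+ 2 = 1 ->
  exists2 s : R, 0 <= s < 2 * pi & Y = circle_point (theta + s).
Proof.
case: Y => x y /= xy1.
have cs := cos2Dsin2 theta.
(* Rotating by - theta avoids reducing an angle modulo 2 pi. *)
have [] := @unit_circle_angle R (x * cos theta + y * sin theta)
  (y * cos theta - x * sin theta).
  (* Rotation preserves the norm: with 1 written as the product of [x ^+ 2 + y ^+ 2] and
     [cos theta ^+ 2 + sin theta ^+ 2], this is a polynomial identity. *)
  rewrite -[RHS]mulr1 -[X in X * 1]xy1 -cs; ring.
move=> s s2pi [c_s s_s]; exists s => //.
rewrite /circle_point cosD sinD -c_s -s_s; congr pair.
  by rewrite -[LHS]mulr1 -cs; ring.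
by rewrite -[LHS]mulr1 -cs; ring.
Qed.

Lemma dist2_ge0 (R : realType) (A B : R * R) : 0 <= dist2 A B.
Proof. exact: sqrtr_ge0. Qed.

(** One witness within [e] of a point bounds the inner infimum at that point, and hence the
    suprema. *)
Lemma hausdorff_dist_le (R : realType) (K L : set (R * R)) (e : R)
    (KL : forall X, K X -> exists2 Y, L Y & dist2 X Y <= e)
    (LK : forall Y, L Y -> exists2 X, K X & dist2 X Y <= e) :
  (hausdorff_dist K L <= e%:E)%E.
Proof.
rewrite /hausdorff_dist ge_max; apply/andP; split; apply: ge_ereal_sup.
  move=> _ [X /KL[Y LY XY] <-]; apply: ge_ereal_inf.
  by exists (dist2 X Y)%:E; [exists Y|rewrite lee_fin].
move=> _ [Y /LK[X KX XY] <-]; apply: ge_ereal_inf.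
by exists (dist2 X Y)%:E; [exists X|rewrite lee_fin].
Qed.

(** The supremum over an empty [K] would be [-oo]; a point of [K] contributes an infimum of
    nonnegative numbers, which is [+oo] if [L] is empty. *)
Lemma hausdorff_dist_ge0 (R : realType) (K L : set (R * R)) (K0 : K !=set0) :
  (0 <= hausdorff_dist K L)%E.
Proof.
case: K0 => X KX; rewrite /hausdorff_dist le_max; apply/orP; left.
apply: le_ereal_sup_tmp.
exists (ereal_inf [set (dist2 X Y)%:E | Y in L]); first by exists X.
by apply: le_ereal_inf_tmp => _ [Y _ <-]; rewrite lee_fin dist2_ge0.
Qed.

Definition unit_circle (R : realType) : set (R * R) :=
  [set X | X.1 ^+ 2 + X.2 ^+ 2 = 1].

Lemma unit_circle_point (R : realType) (a : R) :
  unit_circle (circle_point a).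
Proof. exact: cos2Dsin2. Qed.

Lemma unit_circle_polyellipse (R : realType) : is_polyellipse (@unit_circle R).
Proof.
exists 1%N, (fun=> (0, 0)), 1; split => //; last first.
  by exists (circle_point 0); exact: unit_circle_point.
apply/seteqP; split => X; rewrite /unit_circle /= big_ord1 /dist2/= !subr0.
  by move=> ->; rewrite sqrtr1.
move=> /(congr1 (fun r => r ^+ 2)).
by rewrite sqr_sqrtr ?addr_ge0 ?sqr_ge0// expr1n.
Qed.

Lemma hausdorff_dist_gon_circle (R : realType) (p : nat) (P : set (R * R))
    (p0 : (0 < p)%N) (regP : is_regular_gon p P) :
  (hausdorff_dist P (@unit_circle R) <= (4 * pi * p%:R^-1)%:E)%E.
Proof.
have [theta ->] := regP.
have pi0 := pi_gt0 R.
have pR0 : 0 < p%:R :> R by rewrite ltr0n.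
have step0 : 0 <= 2 * pi / p%:R :> R by rewrite divr_ge0 ?mulr_ge0 ?ltW.
have twice : 4 * pi * p%:R^-1 = (2 * pi / p%:R) *+ 2 :> R.
  by rewrite -mulr_natl; ring.
apply: hausdorff_dist_le => [X [k kp /dist2_segment_circle XV]|Y].
  exists (gon_vertex p theta k); first exact: unit_circle_point.
  rewrite twice; apply: le_trans XV _.
  have -> : theta + 2 * pi * k%:R / p%:R - (theta + 2 * pi * k.+1%:R / p%:R)
      = - (2 * pi / p%:R) by rewrite -natr1; ring.
  by rewrite normrN ger0_norm// divr_ge0 ?mulr_ge0 ?ltW.
move=> /(circle_angle_from theta)[s /andP[s0 s2pi] ->].
have q0 : 0 <= p%:R * s / (2 * pi).
  by rewrite divr_ge0// mulr_ge0// ltW.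
(* Vertex [k] is the last one met before or at angle [theta + s] when starting from [theta];
   [s < 2 * pi] gives [k < p]. *)
set k := Num.truncn (p%:R * s / (2 * pi)).
have sE : s = 2 * pi * (p%:R * s / (2 * pi)) / p%:R.
  by rewrite mulrC (mulrC (2 * pi)) divfK ?mulKf ?lt0r_neq0 ?mulr_gt0.
have /andP[kle ltk] := truncn_itv q0.
exists (gon_vertex p theta k).
  exists k.
    by rewrite truncn_lt_nat// ltr_pdivrMr ?mulr_gt0// ltr_pM2l.
  (* The vertex is the starting point of edge [k]. *)
  exists 0; first by rewrite /= in_itv/= lexx ler01.
  by rewrite /line_path subr0 !mul1r !mul0r !addr0.
rewrite twice; apply: le_trans (dist2_circle_point _ _) _.
rewrite lerMn2r/=.
(* The angular gap is the fractional part of [p%:R * s / (2 * pi)] times the angular step, hence at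
   most one step. *)
have -> : theta + 2 * pi * k%:R / p%:R - (theta + s)
    = - ((p%:R * s / (2 * pi) - k%:R) * (2 * pi / p%:R)).
  rewrite {1}sE; ring.
rewrite normrN ger0_norm; last by rewrite mulr_ge0// subr_ge0.
rewrite ler_piMl//.
by rewrite lerBlDl natr1 ltW.
Qed.

Lemma regular_gon_nonempty (R : realType) (p : nat) (P : set (R * R))
    (p0 : (0 < p)%N) (regP : is_regular_gon p P) : P !=set0.
Proof.
have [theta ->] := regP.
exists (line_path (gon_vertex p theta 0).1 (gon_vertex p theta 1).1 0,
        line_path (gon_vertex p theta 0).2 (gon_vertex p theta 1).2 0).
by exists 0%N => //; exists 0 => //; rewrite /= in_itv/= lexx ler01.
Qed.

Theorem mainTheorem3 (R : realType) (P : nat -> set (R * R))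
    (regP : forall p : nat, (3 <= p)%N -> is_regular_gon p (P p)) :
  ereal_inf [set hausdorff_dist (P p) E | E in @is_polyellipse R]
    @[p --> \oo] --> 0%:E.
Proof.
have bound_cvg : (4 * pi * n%:R^-1 : R)%:E @[n --> \oo] --> 0%:E.
  apply/cvg_EFin; first exact: nearW.
  (* The harmonic sequence has terms [n.+1%:R^-1], hence the shift by one. *)
  rewrite -(cvg_shiftS (fun n => 4 * pi * n%:R^-1 : R)).
  have := cvgM (cvg_cst (4 * pi : R)) (@cvg_harmonic R).
  by rewrite mulr0; apply.
apply: (squeeze_cvge _ (cvg_cst 0%:E) bound_cvg).
(* The squeeze is only required eventually, which allows restricting to [3 <= p], where [regP]
   applies. *)
near=> p.
have p3 : (3 <= p)%N by near: p; exists 3%N.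
have p0 : (0 < p)%N by apply: leq_trans p3.
apply/andP; split.
  apply: le_ereal_inf_tmp => _ [E _ <-]; apply: hausdorff_dist_ge0.
  exact: regular_gon_nonempty p0 (regP p p3).
apply: ge_ereal_inf; exists (hausdorff_dist (P p) (@unit_circle R)).
  by exists (@unit_circle R) => //; exact: unit_circle_polyellipse.
exact: hausdorff_dist_gon_circle (regP p p3).
Unshelve. all: by end_near.
Qed.
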